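(* Let $d$ and $n$ be positive integers with \[ d+\sqrt{2d+\tfrac14}+\tfrac12\le n\le\tfrac12 d(d+1). \] Then there exists an $n$-packing $\Phi$ in $\mathbb{R}\mathbf{P}^{d-1}$ such that \[ \mu(\Phi)\le 20\sqrt6\cdot\sqrt{\frac{n-d}{d(n-1)}} . \]
   Context: An $n$-packing in $\mathbb{R}\mathbf{P}^{d-1}$ is a sequence $\Phi=\{\varphi_i\}_{i=1}^n$ of $n$ unit vectors in $\mathbb{R}^d$. Its coherence is $\mu(\Phi)=\max_{i\ne j}|\langle\varphi_i,\varphi_j\rangle|$. *)

(* Defs.v *)
From mathcomp Require Export all_boot all_order all_algebra.
From mathcomp Require Export reals.

Set Implicit Arguments.
Unset Strict Implicit.
Unset Printing Implicit Defensive.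

Import Order.TTheory GRing.Theory Num.Theory.
Local Open Scope ring_scope.

Definition dotv (R : realType) (d : nat) (u v : 'rV[R]_d) : R :=
  \sum_(k < d) u 0 k * v 0 k.

(* The norm `|u| on row vectors in mathcomp-analysis is the sup norm, so the
   Euclidean norm is defined separately. *)
Definition enorm (R : realType) (d : nat) (u : 'rV[R]_d) : R :=
  Num.sqrt (dotv u u).

(* An n-packing in RP^(d-1): each line is represented by a unit vector
   spanning it, and lines may be repeated. *)
Definition packing (R : realType) (n d : nat) (Phi : 'I_n -> 'rV[R]_d) : Prop :=
  forall i, enorm (Phi i) = 1.

(* All the terms are nonnegative, so the default value 0 only matters when
   there is no pair i != j, that is, when n <= 1. *)
Definition coherence (R : realType) (n d : nat) (Phi : 'I_n -> 'rV[R]_d) : R :=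
  \big[Num.max/0]_(p : 'I_n * 'I_n | p.1 != p.2)
    `|dotv (Phi p.1) (Phi p.2)|.

(* Main.v *)
Require Import Defs.
From mathcomp Require Import finfield ring lra zify.

Import Order.TTheory GRing.Theory Num.Theory.
Local Open Scope ring_scope.

(** Write k = n - d. The left inequality on n says n <= k(k+1)/2, the Gerzon
    bound in dimension k, just as the right one is the Gerzon bound in
    dimension d. The target is, up to the constant, sqrt (k / (d n)).

    Building blocks. Over the field F with q = 2^e elements, let chi be the
    additive character (-1)^Tr. For s = (b, c) in F^2 and a in F, the unit
    vector of R^F with entries chi (b x^3 + c x^5 + a x) / sqrt q is called a
    chirp. For fixed s the chirps form an orthonormal basis, and chirps
    with distinct s have inner product at most 4 / sqrt q in absolute value
    (sum_frob_char_quintic): b x^3 + c x^5 gives a quadratic form over the field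
    with two elements, so the square of the exponential sum is at most q times
    the size of the radical, and the radical is the set of roots of a nonzero
    polynomial of degree at most 16. This gives q^2 orthonormal bases
    of R^q, hence q^3 vectors, of coherence at most 4 / sqrt q.

    Two regimes. Let q be the power of 2 with k <= q < 2k.

    - If n < 2q, then n < 4k, so the target is of order 1 / sqrt d. Take the
      chirps in R^Q, where Q is the power of 2 with Q <= d < 2Q; there are
      Q^3 >= d(d+1)/2 of them (packable_large).

    - If n >= 2q, put m = floor (n / q) >= 2. The union of m chirp bases, scaled
      by 1 / sqrt m, is a Parseval frame of mq vectors in R^q. Its Naimark
      complement has Gram matrix 1 - A^T A, a projection of rank (m - 1) q;
      its vectors have squared norm 1 - 1/m and inner products at most
      4 / (m sqrt q), so after normalization the coherence is at most
      4 / ((m - 1) sqrt q) (packable_chirp_complement), which is of order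
      sqrt k / n.

    The mismatch between (mq, (m - 1) q) and (n, d) is absorbed by adjoining
    n - mq <= d - (m - 1) q unit vectors orthogonal to one another and to
    everything else, at no cost in coherence (packable_extend). *)

Set Implicit Arguments.
Unset Strict Implicit.

(** * The character of a finite field of characteristic two *)

(** The four properties of chi = (-1)^Tr that the construction uses.
    Invariance under the Frobenius map is what allows all the terms of an
    exponent to be brought to a common power of x. *)
Record frob_char (R : realType) (F : finFieldType) (chi : F -> R) : Prop :=
  FrobChar {
    frob_charD : forall x y, chi (x + y) = chi x * chi y;
    frob_char_sqr : forall x, chi x ^+ 2 = 1;
    frob_char_frob : forall x, chi (x ^+ 2) = chi x;
    frob_char_sum : \sum_x chi x = 0 }.

(** The absolute trace Tr x = x + x^2 + ... + x^(2^(e-1)) satisfies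
    (Tr x)^2 = Tr (x^2) = Tr x, so it takes its values in {0, 1}; having degree
    less than the order of F, it does not vanish identically. *)
Lemma frob_char_exists (R : realType) (F : finFieldType) (e : nat) :
  2 \in [pchar F] -> #|F| = (2 ^ e)%N ->
  exists chi : F -> R, frob_char chi.
Proof.
move=> charF cardF.
pose Tr (x : F) := \sum_(i < e) x ^+ (2 ^ i).
have sqD (x y : F) : (x + y) ^+ 2 = x ^+ 2 + y ^+ 2.
  exact: (pFrobenius_autD_comm charF (mulrC x y)).
have TrD x y : Tr (x + y) = Tr x + Tr y.
  rewrite -big_split /=; apply: eq_bigr => i _.
  elim: (i : nat) => [|j IHj]; first by rewrite !expr1.
  by rewrite expnSr !exprM IHj sqD.
have Tr_sqr x : Tr x ^+ 2 = Tr (x ^+ 2).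
  rewrite /Tr; elim: e {cardF Tr TrD} => [|j IHj].
    by rewrite !big_ord0 expr0n.
  by rewrite !big_ord_recr /= sqD IHj -!exprM mulnC.
have Tr_frob x : Tr (x ^+ 2) = Tr x.
  apply: (addrI x); rewrite {2}/Tr /Tr.
  transitivity (\sum_(i < e.+1) x ^+ (2 ^ i)).
    rewrite big_ord_recl expn0 expr1; congr (_ + _).
    by apply: eq_bigr => i _; rewrite -exprM -expnS.
  by rewrite big_ord_recr /= -cardF expf_card addrC.
have Tr01 x : (Tr x == 0) || (Tr x == 1).
  have : Tr x * (Tr x - 1) = 0.
    by rewrite mulrBr mulr1 -expr2 Tr_sqr Tr_frob subrr.
  by move/eqP; rewrite mulf_eq0 subr_eq0.
have [z Trz] : exists z, Tr z != 0.
  have e_gt0 : (0 < e)%N.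
    by move: (finNzRing_gt1 F); rewrite cardF; case: (e).
  pose p : {poly F} := \sum_(i < e) 'X^(2 ^ i).
  have p_neq0 : p != 0.
    apply/eqP => /(congr1 (fun p : {poly F} => p`_1)); rewrite coef0 coef_sum.
    rewrite (bigD1 (Ordinal e_gt0)) //= big1 ?addr0 ?coefXn ?expn0 ?eqxx;
      last first.
      move=> i; rewrite -val_eqE /= coefXn => i_neq0.
      by rewrite -(expn0 2) eqn_exp2l // eq_sym (negPf i_neq0).
    by move/eqP; rewrite oner_eq0.
  have size_p : (size p <= (2 ^ e.-1).+1)%N.
    apply: leq_trans (size_sum _ _ _) _; apply/bigmax_leqP => i _.
    by rewrite size_polyXn ltnS leq_exp2l // -ltnS prednK.
  case: (pickP (fun z => Tr z != 0)) => [z Trz | Tr0]; first by exists z.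
  suff: (size (enum F) < size p)%N.
    rewrite -cardE cardF => /leq_trans/(_ size_p); rewrite ltnS leq_exp2l //.
    by rewrite -ltnS prednK // ltnn.
  apply: max_poly_roots p_neq0 _ (enum_uniq _).
  apply/allP => x _; rewrite /root /p horner_sum.
  under eq_bigr do rewrite hornerXn.
  by have /negbFE := Tr0 x.
have chiD x y : (-1) ^+ (Tr (x + y) != 0) =
    (-1) ^+ (Tr x != 0) * (-1) ^+ (Tr y != 0) :> R.
  rewrite TrD; case/orP: (Tr01 x) => /eqP->; case/orP: (Tr01 y) => /eqP->.
  - by rewrite addr0 eqxx mulr1.
  - by rewrite add0r eqxx mul1r.
  - by rewrite addr0 eqxx mulr1.
  by rewrite addrr_pchar2 // eqxx oner_eq0 mulrNN mulr1.
exists (fun x => (-1) ^+ (Tr x != 0)); split=> [//|x|x|].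
- by rewrite -exprM mulnC exprM sqrrN !expr1n.
- by rewrite Tr_frob.
(* Translation by z, where Tr z = 1, reverses the sign of the sum. *)
set S := \sum_x _; suff : S = - S by move=> ?; lra.
rewrite {1}/S (reindex_inj (addIr z)) /=.
under eq_bigr do rewrite chiD Trz expr1 mulrN1.
by rewrite sumrN.
Qed.

(** * Exponential sums of quadratic forms *)

Lemma sum_frob_char_mul (R : realType) (F : finFieldType) (chi : F -> R)
    (u : F) :
  frob_char chi ->
  \sum_x chi (u * x) = if u == 0 then #|F|%:R else 0.
Proof.
move=> [chiD chi_sqr _ chi_sum].
have [->|u_neq0] := eqVneq u 0; last first.
  by rewrite -[RHS]chi_sum [RHS](reindex_inj (mulfI u_neq0)).
have chi0 : chi 0 = 1 by rewrite -(chi_sqr 0) expr2 -chiD addr0.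
under eq_bigr do rewrite mul0r chi0.
by rewrite sumr_const.
Qed.

(** The map x |-> Tr (b x^3 + c x^5) is a quadratic form over the field with two
    elements, because 3 = 1 + 2 and 5 = 1 + 4 are sums of two powers of 2. *)
Definition quintic (F : finFieldType) (s : F * F) (a x : F) : F :=
  s.1 * x ^+ 3 + s.2 * x ^+ 5 + a * x.

(** The polarization of the form is
    Tr (b (x^2 y + x y^2) + c (x^4 y + x y^4)). Frobenius invariance of the
    trace turns each term into a multiple of x^4, and the sum into
    Tr (L(y) x^4) with
    L(y) = b^2 y^2 + b^4 y^8 + c y + c^4 y^16. So the roots of L form the
    radical. *)
Definition radical_poly (F : finFieldType) (s : F * F) : {poly F} :=
  (s.1 ^+ 2) *: 'X^2 + (s.1 ^+ 4) *: 'X^8 + s.2 *: 'X + (s.2 ^+ 4) *: 'X^16.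

Lemma radical_poly_roots (F : finFieldType) (s : F * F) :
  s != 0 -> (#|[pred y | root (radical_poly s) y]| <= 16)%N.
Proof.
move=> s_neq0; rewrite cardE -ltnS.
have p_neq0 : radical_poly s != 0.
  apply: contra s_neq0 => /eqP p0.
  (* The coefficients b^4 and c^4 already determine whether s is zero. *)
  have := congr1 (fun p : {poly F} => p`_8) p0.
  have := congr1 (fun p : {poly F} => p`_16) p0.
  rewrite !coefE /= !(mulr0, mulr1, addr0, add0r) => /eqP.
  rewrite expf_eq0 /= => /eqP s2_0 /eqP; rewrite expf_eq0 /= => /eqP s1_0.
  by rewrite [s]surjective_pairing s1_0 s2_0.
apply: leq_trans (max_poly_roots p_neq0 _ (enum_uniq _)) _.
  by apply/allP => y; rewrite mem_enum.
apply/leq_sizeP => j le17j; rewrite !coefE !(gtn_eqF (leq_trans _ le17j)) //.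
by rewrite !mulr0 !addr0.
Qed.

(** The square of the sum is the sum over x and y of chi (f x) chi (f (x + y)),
    and chi (f x) chi (f (x + y)) = chi (f y) chi (L(y) x^4). Summing over x
    first leaves only the roots y of L, each with weight at most #|F|. *)
Lemma sum_frob_char_quintic (R : realType) (F : finFieldType) (chi : F -> R)
    (s : F * F) (a : F) :
  2 \in [pchar F] -> frob_char chi -> s != 0 ->
  (\sum_x chi (quintic s a x)) ^+ 2 <= 16 * #|F|%:R.
Proof.
move=> charF chiP s_neq0; have [chiD chi_sqr chi_frob _] := chiP.
have two0 : 2%:R = 0 :> F by exact: pcharf0.
have chi_frob4 x : chi (x ^+ 4) = chi x by rewrite (exprM x 2 2) !chi_frob.
have chi_le1 x : chi x <= 1.
  by have := chi_sqr x; nra.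
have sqr_inj : injective (fun x : F => x ^+ 2).
  exact: (fmorph_inj (pFrobenius_aut charF)).
have pow4_inj : injective (fun x : F => x ^+ 4).
  by move=> x y /=; rewrite !(exprM _ 2 2) => /sqr_inj/sqr_inj.
have diff x y : chi (quintic s a x) * chi (quintic s a (x + y)) =
    chi (quintic s a y) * chi ((radical_poly s).[y] * x ^+ 4).
  have -> : (radical_poly s).[y] * x ^+ 4 =
      (s.1 * x ^+ 2 * y) ^+ 2 + (s.1 * x * y ^+ 2) ^+ 4
      + s.2 * x ^+ 4 * y + (s.2 * x * y ^+ 4) ^+ 4.
    by rewrite /radical_poly !(hornerD, hornerZ, hornerXn, hornerX); ring.
  rewrite !chiD chi_frob !chi_frob4 -!chiD; congr chi.
  apply/eqP; rewrite -subr_eq0 /quintic; apply/eqP.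
  (* The two exponents differ by a multiple of 2, which is zero in F. *)
  transitivity (2%:R * (s.1 * x ^+ 3 + s.1 * x ^+ 2 * y + s.1 * x * y ^+ 2
    + s.2 * x ^+ 5 + 2%:R * s.2 * x ^+ 4 * y + 5%:R * s.2 * x ^+ 3 * y ^+ 2
    + 5%:R * s.2 * x ^+ 2 * y ^+ 3
    + 2%:R * s.2 * x * y ^+ 4 + a * x)).
    by ring.
  by rewrite two0 mul0r.
have -> : (\sum_x chi (quintic s a x)) ^+ 2 =
    \sum_(y | root (radical_poly s) y) chi (quintic s a y) * #|F|%:R.
  rewrite expr2 mulr_suml.
  under eq_bigr => x _.
    rewrite mulr_sumr (reindex_inj (addrI x)) /=.
    under eq_bigr do rewrite diff.
    over.
  rewrite exchange_big [RHS]big_mkcond /=; apply: eq_bigr => y _.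
  rewrite -mulr_sumr; set L := _.[y].
  have <- : \sum_x chi (L * x) = \sum_x chi (L * x ^+ 4).
    exact: (reindex_inj pow4_inj).
  by rewrite sum_frob_char_mul // rootE; case: ifP; rewrite ?mulr0.
rewrite -mulr_suml ler_wpM2r //.
apply: (le_trans (ler_sum _ (fun y _ => chi_le1 (quintic s a y)))).
by rewrite sumr_const ler_nat radical_poly_roots.
Qed.

(** * Projections and Naimark complements *)

Lemma dotvE (R : realType) (d : nat) (u v : 'rV[R]_d) :
  u *m v^T = (dotv u v)%:M.
Proof.
apply/matrixP => i j; rewrite !ord1 !mxE eqxx mulr1n.
by apply: eq_bigr => k _; rewrite mxE.
Qed.

Lemma dotvv_ge0 (R : realType) (d : nat) (u : 'rV[R]_d) : 0 <= dotv u u.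
Proof. by apply: sumr_ge0 => k _; rewrite -expr2 sqr_ge0. Qed.

Lemma dotvv_eq0 (R : realType) (d : nat) (u : 'rV[R]_d) :
  (dotv u u == 0) = (u == 0).
Proof.
apply/eqP/eqP => [u0|->]; last by apply: big1 => k _; rewrite !mxE mul0r.
apply/rowP => k; rewrite mxE; apply/eqP; rewrite -sqrf_eq0.
have sq_ge0 l : true -> 0 <= u 0 l * u 0 l by rewrite -expr2 sqr_ge0.
by rewrite expr2; apply/eqP/(psumr_eq0P sq_ge0).
Qed.

Lemma dotvZ (R : realType) (d : nat) (a b : R) (u v : 'rV[R]_d) :
  dotv (a *: u) (b *: v) = a * b * dotv u v.
Proof. by rewrite mulr_sumr; apply: eq_bigr => k _; rewrite !mxE; ring. Qed.

Lemma dotv_row_mx (R : realType) (d1 d2 : nat) (u1 v1 : 'rV[R]_d1)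
    (u2 v2 : 'rV[R]_d2) :
  dotv (row_mx u1 u2) (row_mx v1 v2) = dotv u1 v1 + dotv u2 v2.
Proof.
by rewrite /dotv big_split_ord; congr (_ + _); apply: eq_bigr => k _;
   rewrite ?row_mxEl ?row_mxEr.
Qed.

(** Induction on the dimension d: subtracting from Q the projection onto a unit
    vector u of its range lowers the trace by 1. Bounding the trace, instead of
    fixing the rank, also covers a d larger than the rank of Q. *)
Lemma projection_gram (R : realType) (n d : nat) (Q : 'M[R]_n) :
  Q^T = Q -> Q *m Q = Q -> \tr Q <= d%:R ->
  exists V : 'M[R]_(d, n), V^T *m V = Q.
Proof.
(* A projection whose trace is zero vanishes: its diagonal entries are the
   squared norms of its rows. *)
have diagE (P : 'M[R]_n) i : P^T = P -> P *m P = P ->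
    P i i = dotv (row i P) (row i P).
  move=> P_sym P_idem; rewrite -{1}P_idem -{2}P_sym mxE.
  by apply: eq_bigr => k _; rewrite !mxE.
elim: d Q => [|d IHd] Q Q_sym Q_idem trQ.
  exists 0; rewrite mulmx0; apply/esym/row_matrixP => i; rewrite row0.
  apply/eqP; rewrite -dotvv_eq0 -diagE //.
  have diag_ge0 j : true -> 0 <= Q j j by rewrite diagE // dotvv_ge0.
  have tr0 : \tr Q = 0.
    by apply/eqP; rewrite eq_le trQ; apply: sumr_ge0.
  by rewrite (psumr_eq0P diag_ge0 tr0).
have [->|] := eqVneq Q 0; first by exists 0; rewrite mulmx0.
case: (pickP (fun i => row i Q != 0)) => [i ri_neq0 _|all0]; last first.
  by case/eqP; apply/row_matrixP => i; rewrite row0; apply/eqP/negbFE/all0.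
pose u := (Num.sqrt (dotv (row i Q) (row i Q)))^-1 *: row i Q.
have u_unit : u *m u^T = 1%:M.
  rewrite dotvE dotvZ -invfM -expr2 sqr_sqrtr ?dotvv_ge0 //.
  by rewrite mulVf // dotvv_eq0.
have uQ : u *m Q = u by rewrite -scalemxAl -row_mul Q_idem.
have Qu : Q *m u^T = u^T by rewrite -{1}Q_sym -trmx_mul uQ.
have [||| V VE] := IHd (Q - u^T *m u).
- by rewrite linearB /= trmx_mul trmxK Q_sym.
- rewrite mulmxBl !mulmxBr Q_idem (mulmxA Q) Qu -(mulmxA _ u Q) uQ.
  by rewrite -(mulmxA _ u) (mulmxA u) u_unit mul1mx subrr subr0.
- rewrite linearB /= mxtrace_mulC u_unit mxtrace1.
  by rewrite lerBlDr natr1.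
have colE : (col_mx u V)^T *m col_mx u V = Q.
  by rewrite tr_col_mx mul_row_col VE addrC subrK.
by exists (col_mx u V).
Qed.

(** If the columns of A are the vectors of a Parseval frame, then A A^T = 1, so
    1 - A^T A is a projection of trace #|T| - q, hence a Gram matrix of vectors
    in dimension d. *)
Lemma naimark_complement (R : realType) (T : finType) (q d : nat)
    (v : T -> 'rV[R]_q) :
  (forall x y, \sum_t v t 0 x * v t 0 y = (x == y)%:R) -> (#|T| <= q + d)%N ->
  exists u : T -> 'rV[R]_d,
    forall s t, dotv (u s) (u t) = (s == t)%:R - dotv (v s) (v t).
Proof.
move=> v_parseval leTqd.
pose A := \matrix_(x < q, i < #|T|) v (enum_val i) 0 x.
have AAt : A *m A^T = 1%:M.
  apply/matrixP => x y; rewrite !mxE -v_parseval [RHS]big_enum_val /=.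
  by apply: eq_bigr => i _; rewrite !mxE.
have [||| V VE] := @projection_gram R #|T| d (1%:M - A^T *m A).
- by rewrite linearB /= trmx1 trmx_mul trmxK.
- rewrite mulmxBl !mulmxBr !mul1mx mulmx1 -!mulmxA (mulmxA A) AAt mul1mx.
  by rewrite subrr subr0.
- rewrite linearB /= mxtrace_mulC AAt !mxtrace1 lerBlDr -natrD ler_nat.
  by rewrite addnC.
exists (fun t => row (enum_rank t) V^T) => s t.
transitivity ((V^T *m V) (enum_rank s) (enum_rank t)).
  by rewrite mxE; apply: eq_bigr => k _; rewrite !mxE.
rewrite VE !mxE (inj_eq enum_rank_inj); congr (_ - _).
by apply: eq_bigr => k _; rewrite !mxE !enum_rankK.
Qed.

(** * Families of unit vectors with bounded coherence *)

(** The squared coherence is bounded, rather than the coherence, so that square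
    roots appear only at the very end. The index type is arbitrary because the
    constructions are naturally indexed by field elements. *)
Definition packable (R : realType) (T : finType) (d : nat) (nu : R) : Prop :=
  exists2 Phi : T -> 'rV[R]_d, forall t, dotv (Phi t) (Phi t) = 1 &
    forall s t, s != t -> dotv (Phi s) (Phi t) ^+ 2 <= nu.

Lemma injection_of_card (S T : finType) :
  (#|S| <= #|T|)%N -> exists f : S -> T, injective f.
Proof.
move=> leST; exists (fun x => enum_val (widen_ord leST (enum_rank x))) => x y.
by move=> /enum_val_inj/(congr1 val)/= /val_inj/enum_rank_inj.
Qed.

Lemma packable_leq (R : realType) (S T : finType) (d : nat) (nu : R) :
  (#|S| <= #|T|)%N -> packable T d nu -> packable S d nu.
Proof.
move=> /injection_of_card[f f_inj] [Phi Phi_unit Phi_coh].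
exists (Phi \o f) => [t|s t st]; first exact: Phi_unit.
by apply: Phi_coh; rewrite (inj_eq f_inj).
Qed.

(** Each of the r new dimensions may receive one more vector, orthogonal to all
    the others. *)
Lemma packable_extend (R : realType) (S T : finType) (d r : nat) (nu : R) :
  0 <= nu -> (#|S| <= #|T| + r)%N -> packable T d nu -> packable S (d + r) nu.
Proof.
move=> nu_ge0 leS [Phi Phi_unit Phi_coh].
have leS' : (#|S| <= #|{: T + 'I_r}|)%N by rewrite card_sum card_ord.
apply: (packable_leq leS').
have dot0v m (x : 'rV[R]_m) : dotv 0 x = 0.
  by apply: big1 => k _; rewrite mxE mul0r.
have dotv0 m (x : 'rV[R]_m) : dotv x 0 = 0.
  by apply: big1 => k _; rewrite mxE mulr0.
have dot_delta (i j : 'I_r) :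
    dotv (delta_mx 0 i : 'rV[R]_r) (delta_mx 0 j) = (i == j)%:R.
  rewrite /dotv (bigD1 i) //= big1 ?addr0 => [|k ki]; rewrite !mxE !eqxx /=.
    by rewrite mul1r.
  by rewrite (negPf ki) mul0r.
exists (fun t => match t with
  | inl t => row_mx (Phi t) 0 | inr i => row_mx 0 (delta_mx 0 i) end).
  case=> t; rewrite dotv_row_mx ?dot0v ?dot_delta ?Phi_unit ?eqxx.
    by rewrite addr0.
  by rewrite add0r.
case=> s [] t st; rewrite dotv_row_mx ?dotv0 ?dot0v ?addr0 ?add0r ?expr0n //.
  exact: Phi_coh.
rewrite dot_delta; case: (eqVneq s t) st => [->|_ _]; first by rewrite eqxx.
by rewrite expr0n.
Qed.

Lemma packable_packing (R : realType) (n d : nat) (nu mu : R) :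
  0 <= mu -> nu <= mu ^+ 2 -> packable 'I_n d nu ->
  exists Phi : 'I_n -> 'rV[R]_d, packing Phi /\ coherence Phi <= mu.
Proof.
move=> mu_ge0 le_nu [Phi Phi_unit Phi_coh]; exists Phi; split.
  by move=> i; rewrite /enorm Phi_unit sqrtr1.
apply: bigmax_le => // -[i j] /= ij.
rewrite -(ler_pXn2r (_ : 0 < 2)%N) ?nnegrE //.
by rewrite real_normK ?num_real // (le_trans (Phi_coh _ _ ij)).
Qed.

(** * Chirp bases *)

(** Since chi takes the values 1 and -1, chi y is its own inverse. *)
Lemma frob_charB (R : realType) (F : finFieldType) (chi : F -> R) (x y : F) :
  frob_char chi -> chi x * chi y = chi (x - y).
Proof.
move=> [chiD chi_sqr _ _].
by rewrite -[chi (x - y)]mulr1 -(chi_sqr y) expr2 mulrA -(chiD (x - y)) subrK.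
Qed.

Definition chirp (R : realType) (F : finFieldType) (chi : F -> R)
    (s : F * F) (a : F) : 'rV[R]_#|F| :=
  \row_k ((Num.sqrt #|F|%:R)^-1 * chi (quintic s a (enum_val k))).

Lemma chirp_mul (R : realType) (F : finFieldType) (chi : F -> R)
    (s t : F * F) (a b : F) i j :
  frob_char chi ->
  chirp chi s a 0 i * chirp chi t b 0 j =
  #|F|%:R^-1 * chi (quintic s a (enum_val i) - quintic t b (enum_val j)).
Proof.
move=> chiP; rewrite !mxE mulrACA frob_charB // -invfM -expr2 sqr_sqrtr //.
Qed.

Lemma dotv_chirp (R : realType) (F : finFieldType) (chi : F -> R)
    (s t : F * F) (a b : F) :
  frob_char chi ->
  dotv (chirp chi s a) (chirp chi t b) =
  #|F|%:R^-1 * \sum_x chi (quintic (s - t) (a - b) x).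
Proof.
move=> chiP; rewrite mulr_sumr [RHS]big_enum_val /=; apply: eq_bigr => k _.
by rewrite chirp_mul //; congr (_ * chi _); rewrite /quintic /=; ring.
Qed.

Lemma card_neq0 (R : realType) (F : finFieldType) : #|F|%:R != 0 :> R.
Proof. by rewrite pnatr_eq0 -lt0n (ltnW (finNzRing_gt1 F)). Qed.

Lemma dotv_chirp_basis (R : realType) (F : finFieldType) (chi : F -> R)
    (s : F * F) (a b : F) :
  frob_char chi -> dotv (chirp chi s a) (chirp chi s b) = (a == b)%:R.
Proof.
move=> chiP; rewrite dotv_chirp // subrr.
under eq_bigr do rewrite /quintic /= !mul0r !add0r.
rewrite sum_frob_char_mul // subr_eq0.
by case: eqP => _; rewrite ?mulr0 // mulVf ?card_neq0.
Qed.

Lemma dotv_chirp_cross (R : realType) (F : finFieldType) (chi : F -> R)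
    (s t : F * F) (a b : F) :
  2 \in [pchar F] -> frob_char chi -> s != t ->
  dotv (chirp chi s a) (chirp chi t b) ^+ 2 <= 16 / #|F|%:R.
Proof.
move=> charF chiP st; rewrite dotv_chirp // exprMn.
apply: le_trans (ler_wpM2l _ (sum_frob_char_quintic (a - b) charF chiP _)) _.
- by rewrite sqr_ge0.
- by rewrite subr_eq0.
by rewrite le_eqVlt; apply/orP; left; apply/eqP; field; rewrite card_neq0.
Qed.

(** The dual orthogonality relation: the square matrix of a chirp basis is
    orthogonal, so its columns are orthonormal as well as its rows. *)
Lemma sum_chirp_parseval (R : realType) (F : finFieldType) (chi : F -> R)
    (s : F * F) (i j : 'I_#|F|) :
  frob_char chi ->
  \sum_a chirp chi s a 0 i * chirp chi s a 0 j = (i == j)%:R.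
Proof.
move=> chiP; have [chiD _ _ _] := chiP.
under eq_bigr do rewrite chirp_mul //.
set x := enum_val i; set y := enum_val j.
have shift a : quintic s a x - quintic s a y =
    (quintic s 0 x - quintic s 0 y) + (x - y) * a by rewrite /quintic; ring.
under eq_bigr do rewrite shift chiD.
rewrite -!mulr_sumr sum_frob_char_mul // subr_eq0 (inj_eq enum_val_inj).
have [ij|_] := eqVneq i j; last by rewrite !mulr0.
rewrite /x ij -/y -frob_charB // -expr2 frob_char_sqr // mul1r.
by rewrite mulVf ?card_neq0.
Qed.

Lemma dyadic_field (R : realType) (e : nat) :
  (0 < e)%N ->
  exists (F : finFieldType) (chi : F -> R),
    [/\ 2 \in [pchar F], #|F| = (2 ^ e)%N & frob_char chi].
Proof.
move=> e_gt0.
have [F charF cardF] := pPrimePowerField (isT : prime 2) e_gt0.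
by have [chi chiP] := frob_char_exists R charF cardF; exists F, chi.
Qed.

Lemma packable_chirp (R : realType) (e n : nat) :
  (0 < e)%N -> (n <= (2 ^ e) ^ 3)%N ->
  packable 'I_n (2 ^ e) (16 / (2 ^ e)%:R : R).
Proof.
move=> /(dyadic_field R)[F [chi [charF <- chiP]]] len.
have leF : (#|'I_n| <= #|{: (F * F) * F}|)%N.
  by rewrite card_ord !card_prod mulnn -expnSr.
apply: (packable_leq leF); exists (fun t => chirp chi t.1 t.2).
  by move=> t; rewrite dotv_chirp_basis ?eqxx.
move=> [s a] [t b] /= st.
have [s_t|] := eqVneq s t; last exact: dotv_chirp_cross.
move: st; rewrite s_t xpair_eqE eqxx dotv_chirp_basis //= => /negPf->.
by rewrite expr0n divr_ge0.
Qed.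

(** The Naimark complement of the Parseval frame formed by m of the chirp bases,
    scaled by 1 / sqrt m, normalized to unit vectors. In the complement a vector
    has squared norm c = 1 - 1/m, and inner products of distinct vectors are the
    opposites of those in the frame. *)
Lemma packable_chirp_complement (R : realType) (e m d : nat) :
  (0 < e)%N -> (1 < m <= (2 ^ e) ^ 2)%N -> (m * 2 ^ e <= 2 ^ e + d)%N ->
  packable 'I_(m * 2 ^ e) d (16 / ((2 ^ e)%:R * (m%:R - 1) ^+ 2) : R).
Proof.
move=> /(dyadic_field R)[F [chi [charF <- chiP]]] /andP[m_gt1 lem] led.
have leF : (#|'I_m| <= #|{: F * F}|)%N by rewrite card_ord card_prod mulnn.
have [base base_inj] := injection_of_card leF.
have m_gt1R : 1 < m%:R :> R by rewrite ltr1n.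
have m_neq0 : m%:R != 0 :> R by rewrite gt_eqF // (lt_trans ltr01).
have m1_neq0 : m%:R - 1 != 0 :> R by rewrite subr_eq0 gt_eqF.
pose v (t : 'I_m * F) := (Num.sqrt m%:R)^-1 *: chirp chi (base t.1) t.2.
have vM i a x y : v (i, a) 0 x * v (i, a) 0 y =
    m%:R^-1 * (chirp chi (base i) a 0 x * chirp chi (base i) a 0 y).
  rewrite [v _ 0 x]mxE [v _ 0 y]mxE mulrACA -invfM -expr2 sqr_sqrtr //.
have dot_v s t : dotv (v s) (v t) =
    m%:R^-1 * dotv (chirp chi (base s.1) s.2) (chirp chi (base t.1) t.2).
  by rewrite dotvZ -invfM -expr2 sqr_sqrtr.
have [||u uE] := @naimark_complement R _ #|F| d v.
- move=> x y.
  rewrite -(pair_bigA _ (fun i a => v (i, a) 0 x * v (i, a) 0 y)) /=.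
  under eq_bigr => i _.
    under eq_bigr do rewrite vM.
    rewrite -mulr_sumr sum_chirp_parseval //.
    over.
  by rewrite sumr_const card_ord -mulrnAl -[_ *+ m]mulr_natr mulVf // mul1r.
- by rewrite card_prod card_ord.
have leT : (#|'I_(m * #|F|)| <= #|{: 'I_m * F}|)%N.
  by rewrite card_prod !card_ord.
pose c : R := 1 - m%:R^-1.
have cE : c = (m%:R - 1) / m%:R by rewrite /c; field.
have c_gt0 : 0 < c by rewrite cE divr_gt0 ?subr_gt0 // (lt_trans ltr01).
have dot_u s t : dotv ((Num.sqrt c)^-1 *: u s) ((Num.sqrt c)^-1 *: u t) =
    c^-1 * ((s == t)%:R - dotv (v s) (v t)).
  by rewrite dotvZ uE -invfM -expr2 sqr_sqrtr // ltW.
apply: (packable_leq leT); exists (fun t => (Num.sqrt c)^-1 *: u t).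
  move=> t; rewrite dot_u dot_v dotv_chirp_basis // !eqxx mulr1.
  by rewrite mulVf // gt_eqF.
move=> [i a] [j b] st; rewrite dot_u (negPf st) sub0r mulrN sqrrN dot_v /=.
have [ij|ij] := eqVneq i j.
  move: st; rewrite ij xpair_eqE eqxx dotv_chirp_basis //= => /negPf->.
  by rewrite !mulr0 expr0n divr_ge0 // mulr_ge0 // sqr_ge0.
have := @dotv_chirp_cross R F chi (base i) (base j) a b charF chiP.
rewrite (inj_eq base_inj) => /(_ ij) cross.
rewrite mulrA exprMn; set D := dotv _ _ in cross *.
have -> : 16 / (#|F|%:R * (m%:R - 1) ^+ 2) =
    (c^-1 / m%:R) ^+ 2 * (16 / #|F|%:R) :> R.
  by rewrite cE; field; rewrite card_neq0 m1_neq0 m_neq0.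
by rewrite ler_wpM2l ?sqr_ge0.
Qed.

(** * The two regimes *)

(** The lower bound on n reads n - d - 1/2 >= sqrt (2d + 1/4), and squaring it
    gives (n - d)^2 - (n - d) >= 2d. *)
Lemma gerzon_bounds (R : realType) (d n : nat)
  (hlo : d%:R + Num.sqrt (2%:R * d%:R + 4%:R^-1) + 2%:R^-1 <= n%:R :> R)
  (hhi : n%:R <= 2%:R^-1 * d%:R * (d%:R + 1) :> R) :
  [/\ (d < n)%N, (2 * n <= (n - d) * (n - d + 1))%N & (2 * n <= d * (d + 1))%N].
Proof.
have s_ge0 : 0 <= Num.sqrt (2%:R * d%:R + 4%:R^-1) :> R by apply: sqrtr_ge0.
have d_ge0 : 0 <= d%:R :> R by [].
have s_sqr : Num.sqrt (2%:R * d%:R + 4%:R^-1) ^+ 2 = 2%:R * d%:R + 4%:R^-1 :> R.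
  by apply: sqr_sqrtr; lra.
have dn : (d < n)%N by rewrite -(ltr_nat R); lra.
split=> //; rewrite -(ler_nat R) !natrM natrD ?natrB ?(ltnW dn) //; last by lra.
by nra.
Qed.

(** After squaring, the target is 2400 (n - d) / (d (n - 1)), since
    (20 sqrt 6)^2 = 2400; the constant 150 is 2400 / 16. *)
Lemma coherence_of_packable (R : realType) (d n A : nat) :
  (0 < d < n)%N -> (0 < A)%N ->
  (d * (n - 1) <= 150 * (n - d) * A)%N -> packable 'I_n d (16 / A%:R : R) ->
  exists Phi : 'I_n -> 'rV[R]_d,
    packing Phi /\
    coherence Phi <= 20%:R * Num.sqrt 6%:R *
      Num.sqrt ((n%:R - d%:R) / (d%:R * (n%:R - 1))).
Proof.
move=> /andP[d_gt0 dn] A_gt0 le_dn; apply: packable_packing.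
  by rewrite !mulr_ge0 ?sqrtr_ge0.
have n_gt1 : (1 < n)%N by exact: leq_ltn_trans dn.
have dR : 0 < d%:R :> R by rewrite ltr0n.
have AR : 0 < A%:R :> R by rewrite ltr0n.
have dnR : 0 < n%:R - d%:R :> R by rewrite subr_gt0 ltr_nat.
have nR : 0 < n%:R - 1 :> R by rewrite subr_gt0 ltr1n.
rewrite !exprMn !sqr_sqrtr ?divr_ge0 ?mulr_ge0 ?(ltW dnR) ?(ltW nR) //.
rewrite ler_pdivrMr // [_ * (_ / _)]mulrA mulrAC ler_pdivlMr ?mulr_gt0 //.
move: le_dn; rewrite -(ler_nat R) !natrM !natrB ?(ltnW dn) ?(ltnW n_gt1) //.
lra.
Qed.

(** With Q = 2^e, one has d (d + 1) / 2 <= (2Q - 1) Q <= Q^3, so there are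
    enough chirps in R^Q; the other d - Q dimensions are left for padding. *)
Lemma packable_large (R : realType) (d n e : nat) :
  (0 < e)%N -> (2 ^ e <= d < 2 * 2 ^ e)%N -> (2 * n <= d * (d + 1))%N ->
  packable 'I_n d (16 / (2 ^ e)%:R : R).
Proof.
move=> e_gt0 /andP[le_d d_lt] hn; rewrite -(subnKC le_d).
have len3 : (n - (d - 2 ^ e) <= (2 ^ e) ^ 3)%N.
  by move: (2 ^ e)%N le_d d_lt; nia.
apply: packable_extend (packable_chirp R e_gt0 len3); first by rewrite divr_ge0.
by rewrite !card_ord; lia.
Qed.

Theorem theorem10 (R : realType) (d n : nat) (hd : (0 < d)%N) (hn : (0 < n)%N)
  (hlo : d%:R + Num.sqrt (2%:R * d%:R + 4%:R^-1) + 2%:R^-1 <= n%:R :> R)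
  (hhi : n%:R <= 2%:R^-1 * d%:R * (d%:R + 1) :> R) :
  exists Phi : 'I_n -> 'rV[R]_d,
    packing Phi /\
    coherence Phi <= 20%:R * Num.sqrt 6%:R *
      Num.sqrt ((n%:R - d%:R) / (d%:R * (n%:R - 1))).
Proof.
have [dn gerzon_k gerzon_d] := gerzon_bounds hlo hhi.
have d_gt1 : (1 < d)%N by nia.
set k := (n - d)%N in gerzon_k *; have k_gt1 : (1 < k)%N by nia.
have nE : n = (d + k)%N by rewrite subnKC // ltnW.
have /andP[q_lt le_q] := up_log_bounds (isT : (1 < 2)%N) k_gt1.
set e := up_log 2 k in q_lt le_q.
have e_gt0 : (0 < e)%N by case: (e) le_q k_gt1 => [|//]; rewrite expn0; lia.
have {}q_lt : (2 ^ e < 2 * k)%N by rewrite -(prednK e_gt0) expnS ltn_pmul2l.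
(* The Naimark complement needs at least two bases, that is, n >= 2q. *)
have [le_n|n_lt] := leqP (2 * 2 ^ e) n; last first.
  have /andP[Q_le Q_gt] := trunc_log_bounds (isT : (1 < 2)%N) (ltnW d_gt1).
  set f := trunc_log 2 d in Q_le Q_gt.
  have f_gt0 : (0 < f)%N by case: (f) Q_gt => [|//]; rewrite expn1; lia.
  rewrite expnS in Q_gt.
  apply: (@coherence_of_packable R d n (2 ^ f)).
  - by rewrite hd.
  - by rewrite expn_gt0.
  - rewrite -/k; move: (2 ^ f)%N (2 ^ e)%N Q_gt q_lt n_lt.
    by move=> {hlo hhi gerzon_k gerzon_d} Q q; nia.
  by apply: packable_large; rewrite ?Q_le.
pose m := (n %/ 2 ^ e)%N.
have q_gt0 : (0 < 2 ^ e)%N by rewrite expn_gt0.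
have m_gt1 : (1 < m)%N by rewrite /m leq_divRL.
have le_mq : (m * 2 ^ e <= n)%N by apply: leq_trunc_div.
have n_lt : (n < m.+1 * 2 ^ e)%N by apply: ltn_ceil.
have m_le : (m <= (2 ^ e) ^ 2)%N.
  by move: (2 ^ e)%N le_q q_gt0 le_mq {hlo hhi q_lt le_n n_lt gerzon_d}; nia.
apply: (@coherence_of_packable R d n (2 ^ e * (m - 1) ^ 2)).
- by rewrite hd.
- by rewrite muln_gt0 q_gt0 expn_gt0 subn_gt0 m_gt1.
(* For m >= 2, n < (m + 1) q <= 3 (m - 1) q; moreover q < 2k. *)
- have n_le : (n <= 3 * ((m - 1) * 2 ^ e))%N.
    by rewrite mulnA (leq_trans (ltnW n_lt)) // leq_pmul2r //; lia.
  have n_sqr := leq_mul n_le n_le.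
  have k_le : ((m - 1) ^ 2 * 2 ^ e * 2 ^ e <= (m - 1) ^ 2 * 2 ^ e * (2 * k))%N.
    by rewrite leq_mul2l (ltnW q_lt) orbT.
  have dn_le : (d * (n - 1) <= n * n)%N by rewrite leq_mul ?(ltnW dn) ?leq_subr.
  by rewrite -/k; lia.
have dE : d = ((m - 1) * 2 ^ e + (d - (m - 1) * 2 ^ e))%N.
  by rewrite subnKC // mulnBl mul1n; lia.
have AE : (2 ^ e * (m - 1) ^ 2)%:R = (2 ^ e)%:R * (m%:R - 1) ^+ 2 :> R.
  by rewrite natrM [((m - 1) ^ 2)%:R]natrX natrB // ltnW.
rewrite dE AE.
have mq_le : (m * 2 ^ e <= 2 ^ e + (m - 1) * 2 ^ e)%N.
  by rewrite mulnBl mul1n; lia.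
apply: packable_extend (packable_chirp_complement R e_gt0 _ mq_le).
- by rewrite divr_ge0 // mulr_ge0 // sqr_ge0.
- by rewrite !card_ord; lia.
by rewrite m_gt1.
Qed.
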